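(* Let $t$ be an indeterminate and define polynomials $u_n\in\mathbb{Q}[t]$ (of degree $4n$) by $u_n=0$ for $n<0$, $u_0=1$, and for all $n\ge 0$ \begin{align*} &(n+1)^2u_{n+1} - 2^2\big(16(t^4-6t^3-4t^2+6t-1)(n^2+n)+4t^4-24t^3-12t^2+20t-3\big)u_n\\ &\quad - 2^{11}t(t-1)^3(t+1)\big(8(t^2+2t-1)n^2-2t^2-6t+3\big)u_{n-1}\\ &\quad + 2^{18}t^2(t-1)^6(t+1)^2(2n+1)(2n-3)u_{n-2}=0 . \end{align*} Then for every $n\ge0$, $u_n\in\mathbb{Z}[t]$ and $u_n$ is divisible by $\binom{2n}{n}$ in $\mathbb{Z}[t]$. *)

(* Defs.v *)
From HB Require Import structures.
From mathcomp Require Import all_boot all_order all_algebra.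
From mathcomp Require Import zify ring.

Set Implicit Arguments.
Unset Strict Implicit.
Unset Printing Implicit Defensive.

Import Order.TTheory GRing.Theory Num.Theory.
Local Open Scope ring_scope.

(* The left-hand side of the recurrence at the index n, the unknowns
   u_{n+1}, u_n, u_{n-1}, u_{n-2} being replaced by a, b, c, d. *)
Definition rec_lhs (n a b c d : {poly rat}) : {poly rat} :=
  let t : {poly rat} := 'X in
  (n + 1) ^+ 2 * a
  - 2 ^+ 2 * (16 * (t ^+ 4 - 6 * t ^+ 3 - 4 * t ^+ 2 + 6 * t - 1) * (n ^+ 2 + n)
              + 4 * t ^+ 4 - 24 * t ^+ 3 - 12 * t ^+ 2 + 20 * t - 3) * b
  - 2 ^+ 11 * t * (t - 1) ^+ 3 * (t + 1)
      * (8 * (t ^+ 2 + 2 * t - 1) * n ^+ 2 - 2 * t ^+ 2 - 6 * t + 3) * c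
  + 2 ^+ 18 * t ^+ 2 * (t - 1) ^+ 6 * (t + 1) ^+ 2
      * (2 * n + 1) * (2 * n - 3) * d.

Definition u_spec (u : int -> {poly rat}) : Prop :=
  [/\ forall n : int, n < 0 -> u n = 0,
      u 0 = 1
    & forall n : int, 0 <= n ->
        rec_lhs n%:~R (u (n + 1)) (u n) (u (n - 1)) (u (n - 2)) = 0].

(* u_spec is satisfiable: the leading factor (n + 1)^2 is a unit. *)
Definition next_u (n : nat) (b c d : {poly rat}) : {poly rat} :=
  - ((n.+1%:R ^+ 2)^-1 *: rec_lhs n%:R 0 b c d).

Fixpoint u_state (n : nat) : {poly rat} * {poly rat} * {poly rat} :=
  if n is m.+1 then
    let: (b, c, d) := u_state m in (next_u m b c d, b, c)
  else (1, 0, 0).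

Lemma u_spec_satisfiable : exists u, u_spec u.
Proof.
exists (fun n : int => if n is Posz m then (u_state m).1.1 else 0).
split=> [[m|m]|//|[m|m]] // _.
have -> : Posz m + 1 = Posz m.+1 by lia.
have H1 : (u_state m).1.2 =
    (if Posz m - 1 is Posz k then (u_state k).1.1 else 0).
  case: m => [|k] //; have -> : Posz k.+1 - 1 = Posz k by lia.
  by rewrite /=; case: (u_state k) => [[? ?] ?].
have H2 : (u_state m).2 =
    (if Posz m - 2 is Posz k then (u_state k).1.1 else 0).
  case: m {H1} => [|[|k]] //; have -> : Posz k.+2 - 2 = Posz k by lia.
  by rewrite /=; case: (u_state k) => [[? ?] ?].
rewrite -H1 -H2 /=; case: (u_state m) => [[b c] d] /=.
have lhs0 x a : rec_lhs x a b c d = (x + 1) ^+ 2 * a + rec_lhs x 0 b c d.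
  by rewrite /rec_lhs; ring.
rewrite lhs0 /next_u pmulrn natr1 mulrN -scalerAr.
have -> : (m.+1%:R : {poly rat}) ^+ 2 = (m.+1%:R ^+ 2)%:P.
  by rewrite rmorphXn /= rmorph_nat.
by rewrite mul_polyC scalerA mulVf ?scale1r ?addNr // expf_neq0 // pnatr_eq0.
Qed.

(* Main.v *)
From HB Require Import structures.
Require Import Defs.
From mathcomp Require Import all_boot all_order all_algebra.
From mathcomp Require Import boolp.
From mathcomp Require Import zify ring.

Set Implicit Arguments.
Unset Strict Implicit.
Unset Printing Implicit Defensive.

Import Order.TTheory GRing.Theory Num.Theory.
Local Open Scope ring_scope.

(* Put u_n = C(2n, n) v_n.  The series with even coefficients v_n turns out to
   be algebraic over Z[t](y).  With e = (t - 1)^3 and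
     Q = 1 + 64 t (t^2 + t - 1) y^2 - 1024 t^2 e (t + 1) y^4,
     L = 1 - 16 e (t + 1) y^2,            T = 1 - 32 e y^2,
     U = 8 y (2 t - 1 - 32 t e y^2),      N = 2 (2 t - 1) - 128 t e (t + 1) y^2,
   one has the Pell-type relation Q T^2 - L U^2 = 1, so
   h = T sqrt Q + U sqrt L is a unit whose logarithmic derivative is
   4 N / sqrt (Q L).  For g = h^(1/4), the pair
     W = (g + 1/g) / (2 sqrt (Q L)),      S = (g - 1/g) / 2
   satisfies S' = N W and 2 P W' + P' W = 2 N S with P = Q L.  Eliminating S
   yields a third order equation for W, and hence the recurrence of the v_n for
   v_n = [y^(2n)] W.  Since sqrt Q and sqrt L are congruent to 1 modulo 8 y,
   so is h, whence g = 1 + 2 y j with j integral, and W is integral.  The degree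
   of u_n is read off from the recurrence, where only the first two terms
   contribute to the leading coefficient. *)

(** * Formal power series *)

Record fps (R : Type) := Fps { fps_coef :> nat -> R }.

Lemma fpsP (R : Type) (f g : fps R) : (forall n, f n = g n) -> f = g.
Proof.
by case: f g => f [g] /= fg; congr Fps; apply: funext.
Qed.

(** The algebraic hierarchy asks for decidable equality and a choice operator; for infinite
    sequences both are supplied classically. *)
HB.instance Definition _ (R : Type) := gen_eqMixin (fps R).
HB.instance Definition _ (R : Type) := gen_choiceMixin (fps R).

Section FpsZmodule.
Variable R : comNzRingType.
Implicit Types f g h : fps R.

Let add f g : fps R := Fps (fun n => f n + g n).
Let opp f : fps R := Fps (fun n => - f n).
Let zero : fps R := Fps (fun=> 0).

Let addA : associative add.
Proof. by move=> f g h; apply: fpsP => n; rewrite /= addrA. Qed.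
Let addC : commutative add.
Proof. by move=> f g; apply: fpsP => n; rewrite /= addrC. Qed.
Let add0 : left_id zero add.
Proof. by move=> f; apply: fpsP => n; rewrite /= add0r. Qed.
Let addN : left_inverse zero opp add.
Proof. by move=> f; apply: fpsP => n; rewrite /= addNr. Qed.

HB.instance Definition _ := GRing.isZmodule.Build (fps R) addA addC add0 addN.

Lemma fpsD f g n : (f + g) n = f n + g n. Proof. by []. Qed.
Lemma fpsN f n : (- f) n = - f n. Proof. by []. Qed.

End FpsZmodule.

Section FpsRing.
Variable R : comNzRingType.
Implicit Types f g h : fps R.

Definition fpsC (c : R) : fps R := Fps (fun n => if n is 0 then c else 0).

Let mul f g : fps R :=
  Fps (fun n => \sum_(i < n.+1) f i * g (n - i)%N).

Definition truncation m f : {poly R} := \poly_(i < m) f i.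

Let coef_truncation m f n : (n < m)%N -> (truncation m f)`_n = f n.
Proof. by move=> nm; rewrite coef_poly nm. Qed.

(* Ring identities for power series are inherited from polynomials. *)
Let mulE m f g n : (n < m)%N ->
  mul f g n = (truncation m f * truncation m g)`_n.
Proof.
move=> nm; rewrite coefM; apply: eq_bigr => i _.
by rewrite !coef_truncation //; have := ltn_ord i; lia.
Qed.

(** Truncating at [m] loses only indices at least [m], and a further product never lowers an index.
    Associativity thus reduces to that of polynomials. *)
Let coef_mul_trunc m f g (p : {poly R}) n : (n < m)%N ->
  (truncation m (mul f g) * p)`_n = (truncation m f * truncation m g * p)`_n.
Proof.
move=> nm; rewrite !coefM; apply: eq_bigr => i _; congr (_ * _).
have im : (i < m)%N by have := ltn_ord i; lia.
by rewrite coef_truncation // (mulE _ _ im).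
Qed.

Let mulC : commutative mul.
Proof.
by move=> f g; apply: fpsP => n; rewrite !(mulE _ _ (ltnSn n)) mulrC.
Qed.

Let mulA : associative mul.
Proof.
move=> f g h; apply: fpsP => n.
rewrite [RHS](mulE _ _ (ltnSn n)) coef_mul_trunc //.
rewrite [LHS](mulE _ _ (ltnSn n)) mulrC coef_mul_trunc //.
by rewrite [_ * truncation _ f]mulrC mulrA.
Qed.

Let mul1 : left_id (fpsC 1) mul.
Proof.
move=> f; apply: fpsP => n; rewrite [LHS]big_ord_recl /= mul1r subn0.
by rewrite big1 ?addr0 // => i _; rewrite mul0r.
Qed.

Let mulD : left_distributive mul +%R.
Proof.
move=> f g h; apply: fpsP => n; rewrite [RHS]fpsD -big_split /=.
by apply: eq_bigr => i _; rewrite mulrDl.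
Qed.

Let one_neq0 : fpsC 1 != 0.
Proof.
by apply/eqP => /(congr1 (fun f : fps R => f 0%N)) /eqP; rewrite oner_eq0.
Qed.

HB.instance Definition _ :=
  GRing.Zmodule_isComNzRing.Build (fps R) mulA mulC mul1 mulD one_neq0.

Lemma fpsM m f g n : (n < m)%N ->
  (f * g) n = (truncation m f * truncation m g)`_n.
Proof. exact: mulE. Qed.

Lemma fps1 n : (1 : fps R) n = (n == 0%N)%:R. Proof. by case: n. Qed.

Lemma fpsCM c f n : (fpsC c * f) n = c * f n.
Proof.
rewrite [LHS]big_ord_recl /= subn0 big1 ?addr0 // => i _; exact: mul0r.
Qed.

Lemma fpsC_is_zmod_morphism : zmod_morphism fpsC.
Proof.
by move=> a b; apply: fpsP => -[|n]; rewrite fpsD fpsN //= subr0.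
Qed.

Lemma fpsC_is_monoid_morphism : monoid_morphism fpsC.
Proof.
by split=> // a b; apply: fpsP => -[|n]; rewrite fpsCM //= mulr0.
Qed.

HB.instance Definition _ :=
  GRing.isZmodMorphism.Build R (fps R) fpsC fpsC_is_zmod_morphism.
HB.instance Definition _ :=
  GRing.isMonoidMorphism.Build R (fps R) fpsC fpsC_is_monoid_morphism.

Definition fpsX : fps R := Fps (fun n => (n == 1%N)%:R).

Lemma fpsXM f n : (fpsX * f) n = if n is m.+1 then f m else 0.
Proof.
case: n => [|n]; rewrite [LHS]big_ord_recl /= mul0r add0r ?big_ord0 //.
rewrite big_ord_recl /= mul1r subSS subn0 big1 ?addr0 // => i _.
by rewrite mul0r.
Qed.

Lemma fpsM0 f g : (f * g) 0%N = f 0%N * g 0%N.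
Proof. by rewrite [LHS]big_ord1. Qed.

(** * Formal derivative, fixed points and quadratic equations *)

Definition fps_deriv f : fps R := Fps (fun n => f n.+1 *+ n.+1).

Lemma fps_derivE f n : fps_deriv f n = f n.+1 *+ n.+1. Proof. by []. Qed.

Lemma fps_deriv_is_zmod_morphism : zmod_morphism fps_deriv.
Proof.
by move=> f g; apply: fpsP => n /=; rewrite mulrnDl mulNrn.
Qed.

HB.instance Definition _ := GRing.isZmodMorphism.Build (fps R) (fps R) fps_deriv
  fps_deriv_is_zmod_morphism.

Lemma fps_derivM f g :
  fps_deriv (f * g) = fps_deriv f * g + f * fps_deriv g.
Proof.
apply: fpsP => n.
have coefT h i : (i < n.+1)%N -> (truncation n.+2 h)^`()`_i = fps_deriv h i.
  by move=> lt_in; rewrite coef_deriv coef_truncation.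
rewrite fps_derivE (fpsM _ _ (ltnSn n.+1)) -coef_deriv derivM coefD fpsD.
congr (_ + _); rewrite coefM; apply: eq_bigr => i _.
  by rewrite coefT // coef_truncation //; lia.
by rewrite coefT ?coef_truncation //; have := ltn_ord i; lia.
Qed.

Lemma fps_derivC c : fps_deriv (fpsC c) = 0.
Proof. by apply: fpsP => n; rewrite fps_derivE mul0rn. Qed.

Lemma fps_derivX : fps_deriv fpsX = 1.
Proof. by apply: fpsP => -[|n]; rewrite fps1 /= ?mul0rn. Qed.

(** Iterating [m] times from 0 already fixes the first [m] coefficients, so the solution is read off
    diagonally from the iterates. *)
Lemma fps_fixpoint (Phi : fps R -> fps R) :
  (forall f g n, (forall i, (i < n)%N -> f i = g i) -> Phi f n = Phi g n) ->
  exists f, f = Phi f.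
Proof.
move=> contr.
have stable m k i : (i < m)%N -> iter (m + k) Phi 0 i = iter m Phi 0 i.
  elim: m i => // m IH i im; apply: contr => j ji; apply: IH.
  by apply: leq_trans ji _.
exists (Fps (fun n => iter n.+1 Phi 0 n)); apply: fpsP => n /=.
apply: contr => i lt_in.
by have := stable i.+1 (n - i.+1)%N i (ltnSn i); rewrite subnKC.
Qed.

(** The factor [fpsX] makes the right-hand side depend on earlier coefficients only. Inverses and
    square roots are obtained from this over [R] itself, without division. *)
Lemma fps_quadratic (a b c : fps R) :
  exists f, f = a + fpsX * (b * f + c * f * f).
Proof.
have M (h f' g' : fps R) m :
    (forall i, (i < m.+1)%N -> f' i = g' i) -> (h * f') m = (h * g') m.
  by move=> E; apply: eq_bigr => i _; rewrite E //; lia.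
apply: fps_fixpoint => f g [|n] fg; rewrite !fpsD !fpsXM //; congr (_ + _).
rewrite !fpsD; congr (_ + _); first exact: M.
rewrite (M _ _ _ _ fg) (mulrC (c * f)) (mulrC (c * g)).
by apply: (M) => i lt_in; apply: M => j ji; apply: fg; lia.
Qed.

Lemma fps_inverse (b : fps R) : exists f, (1 + fpsX * b) * f = 1.
Proof.
have [f fE] := fps_quadratic 1 (- b) 0; exists f.
by rewrite mulrDl mul1r {1}fE; ring.
Qed.

End FpsRing.

(** * The differential system and its recurrence *)

(** Primed letters are inverses, not derivatives. The conditions on the derivatives of [T] and [U]
    give [g ^+ 4] the logarithmic derivative [4 N / (a b)]. Hence [g] has [N / (a b)] and [1 / g]
    its opposite; the system follows from their difference and sum. *)
Lemma radical_ode (R : comNzRingType) (Q L T U N a b g a' b' g' S W : fps R) :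
    injective (fun f : fps R => 2 * f) ->
    a * a = Q -> b * b = L -> g ^+ 4 = T * a + U * b ->
    2 * fps_deriv T * Q + T * fps_deriv Q = 8 * N * U ->
    2 * fps_deriv U * L + U * fps_deriv L = 8 * N * T ->
    a * a' = 1 -> b * b' = 1 -> g * g' = 1 ->
    2 * S = g - g' -> 2 * (a * b * W) = g + g' ->
  fps_deriv S = N * W /\
  2 * (Q * L) * fps_deriv W + fps_deriv (Q * L) * W = 2 * N * S.
Proof.
move=> inj2 aQ bL gTU eT eU aa' bb' gg' SE WE; pose D := @fps_deriv R.
have inj8 (f h : fps R) : 8 * f = 8 * h -> f = h.
  by move=> e; do 3 apply: (inj2); rewrite !mulrA -!natrM.
have DQ : D Q = 2 * a * D a by rewrite -aQ /D fps_derivM; ring.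
have DL : D L = 2 * b * D b by rewrite -bL /D fps_derivM; ring.
have D1 : fps_deriv (1 : fps R) = 0 by exact: (fps_derivC 1).
have D2 : fps_deriv (2 : fps R) = 0.
  by rewrite mulr2n raddfD /= D1 addr0.
have Dh : a * b * D (g ^+ 4) * 2 = 8 * N * g ^+ 4.
  rewrite {1}gTU /D raddfD /= !fps_derivM -/D.
  transitivity (b * (2 * D T * Q + T * D Q) + a * (2 * D U * L + U * D L)).
    by rewrite DQ DL -aQ -bL; ring.
  by rewrite /D eT eU gTU; ring.
have Dg : a * b * D g = N * g.
  have Dg4 : D (g ^+ 4) = 4 * g ^+ 3 * D g.
    by rewrite !exprS expr0 mulr1 /D !fps_derivM; ring.
  apply: inj8; transitivity (a * b * D (g ^+ 4) * 2 * g' ^+ 3).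
    rewrite Dg4; transitivity (8 * (a * b * D g) * (g * g') ^+ 3); last by ring.
    by rewrite gg' expr1n mulr1.
  rewrite Dh; transitivity (8 * (N * g) * (g * g') ^+ 3); first by ring.
  by rewrite gg' expr1n mulr1.
have Dg' : a * b * D g' = - (N * g').
  have e : D g * g' + g * D g' = 0 by rewrite /D -fps_derivM gg' D1.
  transitivity (g' * (a * b * (D g * g' + g * D g')) - a * b * D g * g' ^+ 2
                + a * b * D g' * (1 - g * g')); first by ring.
  rewrite e gg' subrr !mulr0 addr0 sub0r Dg; congr (- _).
  by transitivity (N * g' * (g * g')); [ring | rewrite gg' mulr1].
have DS : 2 * D S = D g - D g'.
  by rewrite /D -raddfB /= -SE fps_derivM D2 mul0r add0r.
have DW : 2 * D (a * b * W) = D g + D g'.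
  by rewrite /D -[RHS]raddfD /= -WE [RHS]fps_derivM D2 mul0r add0r.
have cancel_ab (f h : fps R) : a * b * f = a * b * h -> f = h.
  move=> /(congr1 (fun x => a' * b' * x)) e.
  have ab1 x : x = a' * b' * (a * b * x).
    transitivity (a * a' * (b * b') * x); last by ring.
    by rewrite aa' bb' !mul1r.
  by rewrite (ab1 f) e -ab1.
split.
  apply: cancel_ab; apply: inj2 => /=.
  transitivity (a * b * (2 * D S)); first by rewrite /D; ring.
  transitivity (N * (2 * (a * b * W))); last by ring.
  by rewrite DS mulrBr Dg Dg' WE; ring.
transitivity (a * b * (2 * D (a * b * W))).
  rewrite /D !fps_derivM -/D DQ DL -aQ -bL; ring.
rewrite DW mulrDr Dg Dg'; transitivity (N * (2 * S)); last by ring.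
by rewrite SE; ring.
Qed.

(** Subtraction on [nat] stops at 0; the guard instead gives terms of negative index the value 0, as
    for [u_n]. *)
Definition lag (R : nmodType) (w : nat -> R) (m j : nat) : R :=
  if (j <= m)%N then w (m - j)%N else 0.

(* [S] cancels thanks to the condition on [N], which holds for
   [N = n0 + n2 y^2]. *)
Lemma eliminate_odd_part (R : comNzRingType) (N S W F : fps R)
    (D := @fps_deriv R) (y := fpsX R) :
    y * D (D N) = D N -> D S = N * W -> F = 2 * N * S ->
  y * D (D F) - D F = 2 * (3 * y * N * D N * W + y * N ^+ 2 * D W - N ^+ 2 * W).
Proof.
move=> DDN DS ->.
have D1 : D 1 = 0 by exact: (fps_derivC 1).
have D2 : D 2 = 0 by rewrite mulr2n /D raddfD /= -/D D1 addr0.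
have DM f g : D (f * g) = D f * g + f * D g by exact: fps_derivM.
have DA f g : D (f + g) = D f + D g by exact: raddfD.
rewrite !(DM, DA, DS, D2).
transitivity (2 * (y * D (D N) - D N) * S
  + 2 * (3 * y * N * D N * W + y * N ^+ 2 * D W - N ^+ 2 * W)); first by ring.
by rewrite DDN subrr; ring.
Qed.

(** For [F = 2 P W' + P' W], the coefficient of [y^m] in [y F'' - F'] is [(m^2 - 1) F_(m+1)], whence
    the factor on the left. Since [P] and [N] are even, only indices of the parity of [m] occur. *)
Lemma even_ode_coef (R : comNzRingType) (p2 p4 p6 n0 n2 : R) (S W : fps R)
    (y : fps R := fpsX R)
    (P := 1 + fpsC p2 * y ^+ 2 + fpsC p4 * y ^+ 4 + fpsC p6 * y ^+ 6)
    (N := fpsC n0 + fpsC n2 * y ^+ 2) (m : nat) :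
    fps_deriv S = N * W ->
    2 * P * fps_deriv W + fps_deriv P * W = 2 * N * S ->
  (m%:R ^+ 2 - 1) *
    ((2 * m%:R + 4) * W m.+2 + p2 * (2 * m%:R + 2) * W m
     + p4 * (2 * m%:R) * lag W m 2 + p6 * (2 * m%:R - 2) * lag W m 4)
  = n0 ^+ 2 * (2 * m%:R - 2) * W m + 4 * n0 * n2 * m%:R * lag W m 2
    + n2 ^+ 2 * (2 * m%:R + 2) * lag W m 4.
Proof.
move=> DS DW; pose D := @fps_deriv R.
have DX : D y = 1 by exact: fps_derivX.
have D1 : D 1 = 0 by exact: (fps_derivC 1).
have D2 : D 2 = 0 by rewrite mulr2n /D raddfD /= -/D D1 addr0.
have DP : fps_deriv P =
    2 * fpsC p2 * y + 4 * fpsC p4 * y ^+ 3 + 6 * fpsC p6 * y ^+ 5.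
  rewrite /P !exprS expr0 !mulr1 !raddfD /= !fps_derivM !fps_derivC -/D ?D1 DX.
  by ring.
have DN : D N = 2 * fpsC n2 * y.
  rewrite /N expr2 /D !raddfD /= !fps_derivM !fps_derivC -/D DX.
  by ring.
have DDN : y * D (D N) = D N.
  by rewrite DN /D !fps_derivM !fps_derivC -/D D2 DX; ring.
have ode := eliminate_odd_part DDN DS DW.
pose W' := D W.
(* Multiplications by [y] are nested one at a time so that [fpsXM] turns each into a shift. *)
have FE : 2 * P * fps_deriv W + fps_deriv P * W
    = fpsC 2 * W' + fpsC (2 * p2) * (y * (y * W') + y * W)
      + fpsC (2 * p4) * (y * (y * (y * (y * W')))
                         + fpsC 2 * (y * (y * (y * W))))
      + fpsC (2 * p6) * (y * (y * (y * (y * (y * (y * W')))))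
                         + fpsC 3 * (y * (y * (y * (y * (y * W)))))).
  by rewrite DP /P -/D -/W'; ring.
have GE : 2 * (3 * y * N * D N * W + y * N ^+ 2 * D W - N ^+ 2 * W)
    = fpsC (2 * n0 ^+ 2) * (y * W' - W)
      + fpsC (4 * n0 * n2) * (y * (y * (y * W')) + fpsC 2 * (y * (y * W)))
      + fpsC (2 * n2 ^+ 2) * (y * (y * (y * (y * (y * W'))))
                              + fpsC 5 * (y * (y * (y * (y * W))))).
  by rewrite DN /N -/W'; ring.
have /(congr1 (fun f : fps R => f m)) := ode; rewrite FE GE.
(* From [m = 5] on every shift stays in range; each smaller index meets some default value 0. *)
case: m => [|[|[|[|[|m]]]]];
  rewrite /y /D /W' !(fpsD, fpsN, fpsCM, fpsXM, fps_derivE);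
  rewrite /lag /= ?subSS ?subn0;
  move=> E; apply: etrans (etrans _ E) _; clear; ring.
Qed.

(** * The algebraic solution *)

Section AlgebraicSolution.
Variables (R : comNzRingType) (t : R).
Hypothesis inj2 : injective (fun r : R => 2 * r).

Let y : fps R := fpsX R.
Let e : R := (t - 1) ^+ 3.
Let q2 : R := 64 * t * (t ^+ 2 + t - 1).
Let q4 : R := - (1024 * t ^+ 2 * e * (t + 1)).
Let l2 : R := - (16 * e * (t + 1)).
Let n0 : R := 2 * (2 * t - 1).
Let n2 : R := - (128 * t * e * (t + 1)).

(** Every radical is built as a power series over [R], so [W] is integral by construction when [R]
    is [Z[t]]; [inj2] serves to cancel 2 in the verification. The product [Q L] is expanded to fit
    [even_ode_coef]. *)
Lemma algebraic_solution : exists S W : fps R,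
  [/\ W 0%N = 1,
      fps_deriv S = (fpsC n0 + fpsC n2 * y ^+ 2) * W
    & let P := 1 + fpsC (q2 + l2) * y ^+ 2 + fpsC (q4 + q2 * l2) * y ^+ 4
               + fpsC (q4 * l2) * y ^+ 6 in
      2 * P * fps_deriv W + fps_deriv P * W
        = 2 * (fpsC n0 + fpsC n2 * y ^+ 2) * S].
Proof.
pose N := fpsC n0 + fpsC n2 * y ^+ 2.
pose Q := 1 + fpsC q2 * y ^+ 2 + fpsC q4 * y ^+ 4.
pose L := 1 + fpsC l2 * y ^+ 2.
pose T := 1 + fpsC (- 32 * e) * y ^+ 2.
pose c := fpsC (2 * t - 1) + fpsC (- 32 * t * e) * y ^+ 2.
pose U := fpsC 8 * y * c.
(* [sqrt Q = 1 + 8 y q], [sqrt L = 1 + 8 y l], [h = 1 + 8 y H],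
   [sqrt h = 1 + 4 y k] and [g = 1 + 2 y j]. *)
have [q qE] := fps_quadratic (fpsC (4 * t * (t ^+ 2 + t - 1)) * y
  - fpsC (64 * t ^+ 2 * e * (t + 1)) * y ^+ 3) 0 (- 4).
have [l lE] := fps_quadratic (- fpsC (e * (t + 1)) * y) 0 (- 4).
pose H := q + fpsC (- 4 * e) * y * (1 + 8 * y * q) + c * (1 + 8 * y * l).
(* As [(1 + 2 s y f)^2 = 1 + 4 s y (f + s y f^2)], each root solves a quadratic equation with last
   coefficient [- s]: here [s] is 4 for [q] and [l], 2 for [k], 1 for [j]. *)
have [k kE] := fps_quadratic H 0 (- 2).
have [j jE] := fps_quadratic k 0 (- 1).
pose a := 1 + y * (8 * q); pose b := 1 + y * (8 * l); pose g := 1 + 2 * y * j.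
have aQ : a * a = Q.
  transitivity (1 + 16 * y * (q + 4 * y * q ^+ 2)); first by rewrite /a; ring.
  by rewrite {1}qE /Q /q2 /q4 -/y; ring.
have bL : b * b = L.
  transitivity (1 + 16 * y * (l + 4 * y * l ^+ 2)); first by rewrite /b; ring.
  by rewrite {1}lE /L /l2 -/y; ring.
have g4 : g ^+ 4 = T * a + U * b.
  have g2 : g ^+ 2 = 1 + 4 * y * k.
    transitivity (1 + 4 * y * (j + y * j ^+ 2)); first by rewrite /g; ring.
    by rewrite {1}jE -/y; ring.
  transitivity ((g ^+ 2) ^+ 2); first by ring.
  transitivity (1 + 8 * y * (k + 2 * y * k ^+ 2)); first by rewrite g2; ring.
  by rewrite {1}kE /H /T /U /a /b -/y; ring.
have [a' aa'] := fps_inverse (8 * q).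
have [b' bb'] := fps_inverse (8 * l).
have [g' gg'] := fps_inverse (2 * j).
have {}gg' : g * g' = 1 by rewrite -[RHS]gg' /g -/y; ring.
(* These are [(g^2 - 1) / (2 g)] and [(1 + (g - 1)^2 / (2 g)) / (a b)], with the 2 in the
   denominator cancelled thanks to [g = 1 + 2 y j]. *)
pose S := 2 * g' * (y * j + y ^+ 2 * j ^+ 2).
pose W := (1 + 2 * y ^+ 2 * j ^+ 2 * g') * a' * b'.
have D1 : fps_deriv (1 : fps R) = 0 by exact: (fps_derivC 1).
have Dy : fps_deriv y = 1 by exact: fps_derivX.
have [] := @radical_ode R Q L T U N a b g a' b' g' S W.
- move=> f h /= fh; apply: fpsP => n; apply: inj2 => /=.
  by rewrite -!fpsCM rmorph_nat fh.
- exact: aQ.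
- exact: bL.
- exact: g4.
- rewrite /T /Q !exprS expr0 !mulr1 !raddfD /= !fps_derivM !fps_derivC ?D1 Dy.
  by rewrite /U /c /N /n0 /n2 /q2 /q4 /e; ring.
- rewrite /U /c /L !exprS expr0 !mulr1 !fps_derivM !raddfD /= !fps_derivM.
  rewrite !fps_derivC ?D1 Dy.
  by rewrite /T /N /n0 /n2 /l2 /e; ring.
- exact: aa'.
- exact: bb'.
- exact: gg'.
- transitivity (g * (g * g') - g'); first by rewrite /S /g; ring.
  by rewrite gg' mulr1.
- transitivity ((2 + (g - 1) ^+ 2 * g') * (a * a') * (b * b')).
    by rewrite /W /g; ring.
  rewrite aa' bb'; transitivity (2 + (g - 2) * (g * g') + g'); first by ring.
  by rewrite gg'; ring.
move=> DS DW; exists S, W; split=> //.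
  have at0 h : (1 + y * h) 0%N = 1 by rewrite fpsD fpsM0 mul0r addr0.
  have inv0 f h : (1 + y * f) * h = 1 -> h 0%N = 1.
    by move=> /(congr1 (fun z : fps R => z 0%N)); rewrite fpsM0 at0 mul1r.
  have -> : W = (1 + y * (2 * y * j ^+ 2 * g')) * a' * b' by rewrite /W; ring.
  rewrite !fpsM0 at0 (inv0 _ _ aa') (inv0 _ _ bb') !mulr1 //.
rewrite -/N; set P := (X in let P := X in _).
by have -> : P = Q * L by rewrite /P /Q /L; ring.
Qed.

End AlgebraicSolution.

(** * The polynomials u_n *)

Lemma coefM_top (R : nzRingType) (p q : {poly R}) m n :
  (size p <= m.+1)%N -> (size q <= n.+1)%N -> (p * q)`_(m + n) = p`_m * q`_n.
Proof.
move=> sp sq; have m_lt : (m < (m + n).+1)%N by rewrite ltnS leq_addr.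
rewrite coefM (bigD1 (Ordinal m_lt)) //= addKn big1 ?addr0 // => i.
rewrite -val_eqE /= => i_neq; have [im|mi] := ltnP i m.
  by rewrite (nth_default 0 (_ : size q <= m + n - i)%N) ?mulr0 //; lia.
by rewrite (nth_default 0 (_ : size p <= i)%N) ?mul0r //; lia.
Qed.

Lemma natpolyE (n : nat) : (n%:R : {poly rat}) = (n%:R)%:P.
Proof. by rewrite rmorph_nat. Qed.

(** The coefficient of [b] has degree 4 and leading coefficient [16 (2 n + 1)^2], which is nonzero,
    while the bounds on [c] and [d] keep their terms below degree [4 n + 4]. The alternatives
    [c = 0] and [d = 0] cover the initial indices. *)
Lemma size_rec_lhs (n : nat) (a b c d : {poly rat}) :
    rec_lhs n%:R a b c d = 0 -> size b = (4 * n).+1%N ->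
    c = 0 \/ (size c + 3 <= 4 * n)%N -> d = 0 \/ (size d + 6 <= 4 * n)%N ->
  size a = (4 * n.+1).+1%N.
Proof.
move=> rec sb sc sd; pose N : rat := n%:R.
pose K : {poly rat} := Poly [:: - 64 * (N ^+ 2 + N) - 12;
  384 * (N ^+ 2 + N) + 80; - 256 * (N ^+ 2 + N) - 48;
  - 384 * (N ^+ 2 + N) - 96; 64 * (N ^+ 2 + N) + 16].
(* [G] is [t (t - 1)^3 (t + 1)] expanded, whose square occurs with [d]; [H] is the other factor
   occurring with [c]. *)
pose G : {poly rat} := Poly [:: 0; -1; 2; 0; -2; 1].
pose H : {poly rat} :=
  Poly [:: 3 - 8 * N ^+ 2; 16 * N ^+ 2 - 6; 8 * N ^+ 2 - 2].
pose r : {poly rat} := 2 ^+ 11 *: (G * H * c)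
  - (2 ^+ 18 * (2 * N + 1) * (2 * N - 3)) *: (G ^+ 2 * d).
have aE : (N + 1) ^+ 2 *: a = K * b + r.
  apply/eqP; rewrite -subr_eq0 -{}rec -mul_polyC; apply/eqP.
  rewrite /r -!mul_polyC /K /G /H /= !cons_poly_def /rec_lhs natpolyE -/N.
  by ring.
have low : (size r <= 4 * n.+1)%N.
  have sG : (size G <= 6)%N by exact: size_Poly.
  have sH : (size H <= 3)%N by exact: size_Poly.
  rewrite (leq_trans (size_polyD _ _)) // size_polyN geq_max.
  apply/andP; split; apply: leq_trans (size_scale_leq _ _) _.
    case: sc => [->|sc]; first by rewrite mulr0 size_poly0.
    have := size_polyMleq (G * H) c; have := size_polyMleq G H; lia.
  case: sd => [->|sd]; first by rewrite mulr0 size_poly0.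
  have sGG : (size (G * G)%R <= 11)%N.
    by apply: leq_trans (size_polyMleq G G) _; lia.
  by rewrite expr2; apply: leq_trans (size_polyMleq (G * G) d) _; lia.
have sK : (size K <= 5)%N by exact: size_Poly.
have N1 : (N + 1) ^+ 2 != 0 by rewrite expf_neq0 // natr1 pnatr_eq0.
rewrite -(size_scale _ N1) aE.
have KE : K`_4 = 16 * (2 * N + 1) ^+ 2 by rewrite /K coef_Poly /=; ring.
have b_neq0 : b`_(4 * n) != 0.
  rewrite -[(4 * n)%N]/(4 * n).+1.-1 -sb -lead_coefE lead_coef_eq0.
  by rewrite -size_poly_eq0 sb.
have Kb_neq0 : (K * b)`_(4 + 4 * n) != 0.
  rewrite coefM_top ?sb // KE; do 2 apply: mulf_neq0 => //.
  by rewrite expf_neq0 // -natrM natr1 pnatr_eq0.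
have sKb : size (K * b) = (4 * n.+1).+1%N.
  apply/eqP; rewrite eqn_leq; apply/andP; split.
    by have := size_polyMleq K b; rewrite sb; lia.
  rewrite ltnNge; apply: (contra _ Kb_neq0) => s.
  by apply/eqP/nth_default; apply: leq_trans s _; lia.
by rewrite size_polyDl sKb // ltnS.
Qed.

(** * Rescaling by the central binomial coefficients *)

Lemma central_bin_rec n :
  (n.+1 * 'C(2 * n.+1, n.+1) = 2 * (2 * n).+1 * 'C(2 * n, n))%N.
Proof.
rewrite (_ : 2 * n.+1 = (2 * n).+2)%N; last by lia.
have sym : 'C((2 * n).+1, n) = 'C((2 * n).+1, n.+1).
  by rewrite -bin_sub; [congr 'C(_, _); lia | lia].
rewrite binS sym addnn -muln2 mulnA -mul_bin_diag /=; lia.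
Qed.

Section Candidate.
Variable v : nat -> {poly int}.

Definition central_multiple (n : nat) : {poly rat} :=
  map_poly intr ('C(2 * n, n)%:R * v n).

Let c (n : nat) : {poly rat} := 'C(2 * n, n)%:R.
Let V (n : nat) : {poly rat} := map_poly intr (v n).

Let central_multipleE n : central_multiple n = c n * V n.
Proof. by rewrite /central_multiple rmorphM rmorph_nat. Qed.

Let cS n : n.+1%:R * c n.+1 = 2 * (2 * n%:R + 1) * c n.
Proof.
by rewrite /c -natrM central_bin_rec !natrM -(natr1 (2 * n)%N) natrM.
Qed.

(** This and the next two lemmas express the shifted terms through the single binomial [c n], which
    then factors out of the recurrence. *)
Let scale0 n :
  (n%:R + 1) * central_multiple n.+1 = 2 * (2 * n%:R + 1) * c n * V n.+1.
Proof. by rewrite central_multipleE natr1 mulrA cS. Qed.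

Let scale1 n : 2 * (2 * n%:R - 1) * lag central_multiple n 1
  = n%:R * c n * lag V n 1.
Proof.
case: n => [|n]; rewrite /lag /= ?mulr0 ?mul0r // subn1 /= central_multipleE.
by rewrite cS -natr1; ring.
Qed.

Let scale2 n : 4 * (2 * n%:R - 1) * (2 * n%:R - 3) * lag central_multiple n 2
  = n%:R * (n%:R - 1) * c n * lag V n 2.
Proof.
case: n => [|[|n]]; rewrite /lag /= ?mulr0 ?mul0r ?subrr ?mulr0 ?mul0r //.
rewrite !subSS subn0 central_multipleE.
have e1 := cS n.+1; have e0 := cS n.
transitivity ((2 * n%:R + 1) * 2 * (2 * (2 * n%:R + 3) * c n) * V n);
  last first.
  transitivity ((n%:R + 1) * (n.+2%:R * c n.+2) * V n); last first.
    by rewrite -!natr1; ring.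
  rewrite e1; transitivity (2 * (2 * n.+1%:R + 1) * (n.+1%:R * c n.+1) * V n).
    by rewrite e0 -!natr1; ring.
  by rewrite -!natr1; ring.
by rewrite -!natr1; ring.
Qed.
Let t : {poly int} := 'X.
Let q2 : {poly int} := 64 * t * (t ^+ 2 + t - 1).
Let q4 : {poly int} := - (1024 * t ^+ 2 * (t - 1) ^+ 3 * (t + 1)).
Let l2 : {poly int} := - (16 * (t - 1) ^+ 3 * (t + 1)).
Let n0 : {poly int} := 2 * (2 * t - 1).
Let n2 : {poly int} := - (128 * t * (t - 1) ^+ 3 * (t + 1)).

(** The shape of [even_ode_coef] at the index [2 n], with the coefficients of [P = Q L]. *)
Hypothesis v_rec : forall n : nat, let m : {poly int} := (2 * n)%:R in
  (m ^+ 2 - 1) *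
    ((2 * m + 4) * v n.+1 + (q2 + l2) * (2 * m + 2) * v n
     + (q4 + q2 * l2) * (2 * m) * lag v n 1
     + (q4 * l2) * (2 * m - 2) * lag v n 2)
  = n0 ^+ 2 * (2 * m - 2) * v n + 4 * n0 * n2 * m * lag v n 1
    + n2 ^+ 2 * (2 * m + 2) * lag v n 2.

Lemma central_multiple_rec n :
  rec_lhs n%:R (central_multiple n.+1) (central_multiple n)
    (lag central_multiple n 1) (lag central_multiple n 2) = 0.
Proof.
pose N : {poly rat} := n%:R; pose T : {poly rat} := 'X.
have lagV j : lag V n j = map_poly intr (lag v n j).
  by rewrite /lag; case: ifP => // _; rewrite rmorph0.
(* Multiplying by [4 (2 n - 1)], nonzero because [2 n] is even, produces the factors that [scale1]
   and [scale2] require. The result is [2 c n] times the relation [v_rec]. *)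
have nonzero : 4 * (2 * N - 1) != 0.
  apply: mulf_neq0; first by rewrite natpolyE polyC_eq0.
  rewrite subr_eq0 /N -natrM -[1]/(1%:R) !natpolyE (inj_eq polyC_inj).
  by rewrite eqr_nat; apply/eqP; lia.
apply: (mulfI nonzero); rewrite mulr0.
pose K := 2 ^+ 2 * (16 * (T ^+ 4 - 6 * T ^+ 3 - 4 * T ^+ 2 + 6 * T - 1)
  * (N ^+ 2 + N) + 4 * T ^+ 4 - 24 * T ^+ 3 - 12 * T ^+ 2 + 20 * T - 3).
pose G := T * (T - 1) ^+ 3 * (T + 1).
pose H := 8 * (T ^+ 2 + 2 * T - 1) * N ^+ 2 - 2 * T ^+ 2 - 6 * T + 3.
transitivity (4 * (2 * N - 1) * (N + 1) * ((N + 1) * central_multiple n.+1)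
  - 4 * (2 * N - 1) * K * central_multiple n
  - 2 ^+ 12 * G * H * (2 * (2 * N - 1) * lag central_multiple n 1)
  + 2 ^+ 18 * G ^+ 2 * (2 * N + 1)
    * (4 * (2 * N - 1) * (2 * N - 3) * lag central_multiple n 2)).
  by rewrite /rec_lhs /K /G /H -/N -/T; ring.
rewrite scale0 scale1 scale2 central_multipleE !lagV /V -/N.
have /eqP := v_rec n; rewrite -subr_eq0 => /eqP.
move/(congr1 (map_poly (intr : int -> rat))); rewrite rmorph0.
set Z := (X in map_poly _ X) => Z0.
transitivity (2 * c n * map_poly intr Z); last by rewrite Z0 mulr0.
have TE : T = map_poly intr t by rewrite map_polyX.
by rewrite /Z /K /G /H TE /N /n0 /n2 /q2 /q4 /l2; ring.
Qed.

(** The factor [(n + 1)^2] can be cancelled, so the recurrence has only one solution with the given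
    initial values. *)
Lemma u_spec_central_multiple u n :
  u_spec u -> v 0%N = 1 -> u n%:Z = central_multiple n.
Proof.
move=> [u_neg u0 u_rec] v0.
(* The recurrence has depth three, so the induction carries three consecutive values. *)
suff [] : [/\ u n%:Z = central_multiple n,
  u (n%:Z - 1) = lag central_multiple n 1
  & u (n%:Z - 2) = lag central_multiple n 2] by [].
elim: n => [|n [IHn IH1 IH2]].
  split; [|exact: u_neg|exact: u_neg].
  by rewrite u0 /central_multiple v0 mulr1 rmorph_nat.
have lagS j : lag central_multiple n.+1 j.+1 = lag central_multiple n j by [].
have nE : n.+1%:Z - 1 = n%:Z by lia.
have nE2 : n.+1%:Z - 2 = n%:Z - 1 by lia.
rewrite !lagS nE nE2; split=> //; last by rewrite /lag subn0.
have := u_rec n%:Z isT; rewrite IHn IH1 IH2 -[n%:Z%:~R]/(n%:R).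
have <- : n.+1%:Z = n%:Z + 1 by lia.
have lhsE a b c' d : rec_lhs n%:R a b c' d
    = n.+1%:R ^+ 2 * a + rec_lhs n%:R 0 b c' d.
  by rewrite /rec_lhs -natr1; ring.
move=> E; have := etrans E (esym (central_multiple_rec n)).
rewrite (lhsE (u _)) (lhsE (central_multiple _)) => /addIr /mulfI; apply.
by rewrite expf_neq0 // natpolyE polyC_eq0 pnatr_eq0.
Qed.

End Candidate.

(** * Degree and divisibility of [u_n] *)

Lemma size_u_spec u n : u_spec u -> size (u n%:Z) = (4 * n).+1%N.
Proof.
move=> [u_neg u0 u_rec]; elim/ltn_ind: n => -[|n] IH.
  by rewrite u0 size_poly1.
have := u_rec n%:Z isT; rewrite -[n%:Z%:~R]/(n%:R).
have -> : n%:Z + 1 = n.+1%:Z by lia.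
move/size_rec_lhs; apply; first exact: IH.
  case: n IH => [|n] IH; first by left; apply: u_neg.
  by right; rewrite (_ : n.+1%:Z - 1 = n%:Z) ?IH; lia.
case: n IH => [|[|n]] IH; [by left; apply: u_neg..|].
by right; rewrite (_ : n.+2%:Z - 2 = n%:Z) ?IH; lia.
Qed.

Theorem theorem2 (u : int -> {poly rat}) (hu : u_spec u) (n : nat) :
  size (u n%:Z) = (4 * n).+1%N /\
  exists p : {poly int},
    u n%:Z = map_poly intr p /\
    exists q : {poly int}, p = 'C(2 * n, n)%:R * q.
Proof.
split; first exact: size_u_spec.
have inj2 : injective (fun r : {poly int} => 2 * r).
  apply: mulfI; have -> : (2 : {poly int}) = 2%:P by rewrite rmorph_nat.
  by rewrite polyC_eq0.
have [S [W [W0 DS DW]]] := algebraic_solution 'X inj2.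
pose v k := W (2 * k)%N.
exists ('C(2 * n, n)%:R * v n); split; last by exists (v n).
apply: u_spec_central_multiple => // {n} n m.
(* Halving indices turns the lags 2 and 4 of [W] into the lags 1 and 2 of [v]. *)
have lagW j : lag W (2 * n) (2 * j) = lag v n j.
  by rewrite /lag leq_pmul2l // -mulnBr.
have := even_ode_coef (2 * n) DS DW.
rewrite (lagW 1%N : lag W (2 * n) 2 = _) (lagW 2%N : lag W (2 * n) 4 = _).
by rewrite (_ : (2 * n).+2 = 2 * n.+1)%N; last lia.
Qed.
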